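(* The following two statements are equivalent. (i) Almost all odd numbers can be represented as the sum of a squarefree number and a power of $2$. (ii) There do not exist an integer $m\geqslant 1$, pairwise distinct odd primes $p_1,\ldots,p_m$, and integers $a_1,\ldots,a_m$ such that the residue classes $a_j\pmod{\omega(p_j)}$, $1\leqslant j\leqslant m$, cover $\mathbb{Z}$.
   Context: For an odd prime $p$, $\omega(p)=\operatorname{ord}_{p^2}(2)$ denotes the multiplicative order of $2$ in $(\mathbb{Z}/p^2\mathbb{Z})^\ast$. ''Almost all odd numbers'' have a property means that the number of odd integers $n\in[1,X]$ without the property is $o(X)$ as $X\to\infty$. A squarefree number is a positive integer not divisible by the square of any prime, and a power of $2$ is a number $2^k$ with $k\geqslant0$ an integer. Residue classes cover $\mathbb{Z}$ if every integer lies in at least one of them. *)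

(* Defs.v *)
From mathcomp Require Import all_boot all_order all_algebra all_fingroup.
From mathcomp Require Import boolp reals filter topology normedtype landau.

Set Implicit Arguments.
Unset Strict Implicit.
Unset Printing Implicit Defensive.

Import Order.TTheory GRing.Theory Num.Theory.
Import numFieldNormedType.Exports.

Local Open Scope ring_scope.

Definition squarefree (n : nat) : Prop :=
  (0 < n)%N /\ forall q : nat, prime q -> ~~ (q ^ 2 %| n)%N.

Definition squarefree_plus_pow2 (n : nat) : Prop :=
  exists s k : nat, squarefree s /\ n = (s + 2 ^ k)%N.

Definition odd_exceptions (R : realType) (P : nat -> Prop) (X : R) : nat :=
  (\sum_(1 <= n < (Num.truncn X).+1 | odd n && ~~ `[< P n >]) 1)%N.

(* Landau's notation infers a packed filter, which [+oo] does not have. *)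
Canonical pinfty_filter_on (R : realType) :=
  FilterType (pinfty_nbhs R) _.

Definition almost_all_odd (R : realType) (P : nat -> Prop) : Prop :=
  (fun X : R => (odd_exceptions P X)%:R : R) =o_+oo (fun X : R => X).

(* The unit [2] of [Z/p^2]: [insubd] returns the unit whose underlying residue
   is 2 whenever 2 is invertible (see [unit2E]), and the default 1 otherwise. *)
Definition unit2 (p : nat) : {unit 'Z_(p ^ 2)} :=
  insubd (1%g : {unit 'Z_(p ^ 2)}) (2%:R : 'Z_(p ^ 2)).

(* Meaningful for odd primes: the order of 2 in [(Z/p^2)^*]. *)
Definition omega (p : nat) : nat := #[unit2 p]%g.

Lemma unit2E (p : nat) : prime p -> odd p -> val (unit2 p) = 2%:R :> 'Z_(p ^ 2).
Proof.
move=> p_pr p_odd; rewrite val_insubd unitZpE ?coprimeXl ?coprimen2 ?oddX ?p_odd //.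
by rewrite (@ltn_exp2l p 0) ?prime_gt1.
Qed.

Definition covers_Z (m : nat) (a : 'I_m -> int) (d : 'I_m -> nat) : Prop :=
  forall x : int, exists j : 'I_m, (x = a j %[mod (d j)%:Z])%Z.

(* Main.v *)
(* Cover to exceptions: if the classes a_j mod omega(p_j) cover Z, choose by the
   Chinese remainder theorem an odd residue n0 with n0 = 2^(a_j) mod p_j^2 for
   all j; every n in that class exceeds each smaller 2^k by a multiple of some
   p_j^2, and these n have positive density.

   No cover to few exceptions: fix y and M = (y!)^2. For each residue b mod M
   the conditions b = 2^k mod p^2 with p <= y odd forbid at most one class of k
   modulo each omega(p), so some exponent k(b) >= 1 satisfies none of them. An
   odd n = b mod M with n > 2^k(b) can then fail only if q^2 divides n - 2^k(b)
   for a prime q > y. As q is coprime to M, this is one class mod M q^2; summing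
   over b and y < q <= sqrt N leaves at most N / y + O_y(sqrt N) exceptions. *)

Require Import Defs.
From mathcomp Require Import all_boot all_order all_algebra all_fingroup.
From mathcomp Require Import boolp reals normedtype landau.
From mathcomp Require Import cyclic.
From mathcomp Require Import zify ring lra.

Set Implicit Arguments.
Unset Strict Implicit.
Unset Printing Implicit Defensive.

Import Order.TTheory GRing.Theory Num.Theory.

(** * Congruences, counting in residue classes, and a tail of inverse squares *)

Lemma eq_pow2_mod_omega (p k l : nat) : prime p -> odd p ->
  (2 ^ k == 2 ^ l %[mod p ^ 2]) = (k == l %[mod omega p]).
Proof.
move=> p_pr p_odd.
have p2_gt1 : 1 < p ^ 2 by rewrite (@ltn_exp2l p 0) ?prime_gt1.
rewrite /omega -eq_expg_mod_order -(inj_eq val_inj) !FinRing.val_unitX.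
rewrite unit2E // -!natrX.
by rewrite -(inj_eq val_inj) /= !val_Zp_nat.
Qed.

Lemma chinese_seq (I : eqType) (s : seq I) (d r : I -> nat) :
  uniq s -> {in s &, forall i j, i != j -> coprime (d i) (d j)} ->
  exists n, {in s, forall i, n = r i %[mod d i]}.
Proof.
elim: s => [|i s IHs] /=; first by exists 0.
case/andP=> i_s s_uniq cop.
have [||n n_r] := IHs => //.
  by move=> j k j_s k_s; apply: cop; rewrite inE ?j_s ?k_s orbT.
have cop_i : coprime (d i) (\prod_(j <- s) d j).
  rewrite big_seq; elim/big_ind: _ => [|x y|j j_s].
  - exact: coprimen1.
  - by rewrite coprimeMr => -> ->.
  - apply: cop; rewrite ?inE ?eqxx ?j_s ?orbT //.
    by apply: contraNneq i_s => ->.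
exists (chinese (d i) (\prod_(j <- s) d j) (r i) n) => j.
rewrite inE => /predU1P[-> | j_s]; first exact: chinese_modl.
rewrite -n_r //.
have dj : d j %| \prod_(j <- s) d j by rewrite (big_rem j) //= dvdn_mulr.
by rewrite -(modn_dvdm _ dj) chinese_modr // modn_dvdm.
Qed.

(** Division by [D] is injective on a residue class and sends [1..N] into [0..N %/ D]. *)
Lemma count_residue_le (D c N : nat) : 0 < D ->
  count (fun n => n == c %[mod D]) (iota 1 N) <= (N %/ D).+1.
Proof.
move=> D_gt0; rewrite -size_filter -(size_map (fun n => n %/ D)).
rewrite -[leqRHS](size_iota 0) uniq_leq_size //.
  rewrite map_inj_in_uniq ?filter_uniq ?iota_uniq // => m n.
  rewrite !mem_filter => /andP[/eqP m_c _] /andP[/eqP n_c _] mn.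
  by rewrite (divn_eq m D) (divn_eq n D) mn m_c n_c.
move=> _ /mapP[n + ->]; rewrite mem_filter !mem_iota => /andP[_ /andP[_ n_N]].
by rewrite add0n ltnS leq_div2r.
Qed.

(** The numbers [c + i * D] with [i < N %/ D] all lie in [1..N]: [0 < c] admits [i = 0], and [c < D]
    keeps the last one below [N]. *)
Lemma divn_leq_count_residue (D c N : nat) : c < D -> 0 < c ->
  N %/ D <= count (fun n => n == c %[mod D]) (iota 1 N).
Proof.
move=> c_D c_gt0.
rewrite -size_filter -(size_iota 0 (N %/ D)) -(size_map (fun i => c + i * D)).
apply: uniq_leq_size.
  rewrite map_inj_uniq ?iota_uniq // => i j /addnI /eqP.
  by rewrite eqn_pmul2r ?(leq_trans _ c_D) // => /eqP.
move=> _ /mapP[i + ->]; rewrite mem_filter !mem_iota {1}(addnC c) modnMDl eqxx /= => iN.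
rewrite addn_gt0 c_gt0 add1n ltnS.
apply: leq_trans (leq_trunc_div N D).
apply: leq_trans (_ : i.+1 * D <= _); last by rewrite leq_mul2r iN orbT.
by rewrite mulSn leq_add2r ltnW.
Qed.

(** The sum telescopes, since [1/(q+1)^2 <= 1/q - 1/(q+1)]. *)
Lemma sum_divn_sqr_le (F : realFieldType) (N y s : nat) : 0 < y -> y <= s ->
  (((\sum_(y <= q < s) N %/ q.+1 ^ 2)%N%:R : F) <=
     N%:R * (y%:R^-1 - s%:R^-1))%R.
Proof.
move=> y_gt0; elim: s => [|s IHs]; first by rewrite leqn0 => /eqP y0; rewrite y0 in y_gt0.
rewrite leq_eqVlt => /predU1P[<-|]; first by rewrite big_geq // subrr mulr0.
rewrite ltnS => y_s; rewrite big_nat_recr //= natrD.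
have s_gt0 : (0 < s%:R :> F)%R by rewrite ltr0n; lia.
have s1_gt0 : (0 < s.+1%:R :> F)%R by rewrite ltr0n.
have -> : (N%:R * (y%:R^-1 - s.+1%:R^-1) =
  N%:R * (y%:R^-1 - s%:R^-1) + N%:R * (s%:R^-1 - s.+1%:R^-1) :> F)%R by ring.
apply: lerD (IHs y_s) _.
apply: (@le_trans _ _ (N%:R / (s.+1 ^ 2)%:R)%R).
  rewrite ler_pdivlMr ?ltr0n ?expn_gt0 // -natrM ler_nat; exact: leq_trunc_div.
rewrite ler_wpM2l ?ler0n //.
have -> : (s%:R^-1 - s.+1%:R^-1 = (s%:R * s.+1%:R)^-1 :> F)%R.
  rewrite -natr1; field; rewrite natr1; lra.
rewrite lef_pV2 ?posrE ?ltr0n ?expn_gt0 ?mulr_gt0 // -natrM ler_nat.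
by rewrite expnS expn1 leq_mul2r leqnSn orbT.
Qed.

(** * Without a cover, exceptions are rare *)

Definition odd_prime_cover : Prop :=
  exists (m : nat) (p : 'I_m -> nat) (a : 'I_m -> int),
    [/\ (1 <= m)%N,
        forall j : 'I_m, prime (p j) /\ odd (p j),
        injective p
      & covers_Z a (fun j : 'I_m => omega (p j))].

(** The finitely many forbidden classes of exponents miss some integer. Positivity of [k] later
    makes [n - 2 ^ k] odd for odd [n]. *)
Lemma avoiding_exponent (y n : nat) : ~ odd_prime_cover ->
  exists2 k, 0 < k &
    forall p, prime p -> odd p -> p <= y -> n != 2 ^ k %[mod p ^ 2].
Proof.
move=> no_cover.
pose ps := [seq p <- iota 0 y.+1 | prime p && odd p].
pose m := size ps; pose p (j : 'I_m) := nth 0 ps j.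
have pP (j : 'I_m) : prime (p j) /\ odd (p j).
  by have := mem_nth 0 (ltn_ord j); rewrite mem_filter => /andP[/andP].
have p_inj : injective p.
  move=> i j /eqP; rewrite nth_uniq ?filter_uniq ?iota_uniq // => /eqP.
  exact: val_inj.
(* [t j] represents the class of exponents forbidden by [p j]. If [n] is no power of 2 modulo
   [p j ^ 2], the condition is vacuous and 0 is a dummy value. *)
have /choice[t tP] (j : 'I_m) : exists t, forall l,
    n = 2 ^ l %[mod p j ^ 2] -> 2 ^ l = 2 ^ t %[mod p j ^ 2].
  have [[t nt]|] := pselect (exists l, n = 2 ^ l %[mod p j ^ 2]).
    by exists t => l; rewrite nt => ->.
  by move=> nl; exists 0 => l ln; case: nl; exists l.
have [x xP] : exists x : int, forall j : 'I_m,
    (x <> (t j)%:Z %[mod (omega (p j))%:Z])%Z.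
  (* A cover needs at least one class, so the case of no odd prime up to [y] is separate; any
     integer then works. *)
  case: (posnP m) => [m0|m_gt0].
    by exists 0%R => j; have := ltn_ord j; rewrite [X in _ < X]m0.
  apply: contrapT => /forallNP nx; apply: no_cover.
  exists m, p, (fun j => Posz (t j)); split=> // x.
  by apply: contrapT => /forallNP jx; apply: (nx x).
pose L := \prod_j omega (p j).
have L_gt0 : 0 < L by rewrite prodn_gt0 // => j; exact: order_gt0.
(* The missed integer [x] may be negative; reducing it modulo [L] and adding [L] gives a positive
   exponent in the same class modulo every [omega (p j)]. *)
exists (`|(x %% L)%Z| + L)%N; first by rewrite addn_gt0 L_gt0 orbT.
move=> q q_pr q_odd q_y; apply/eqP => nq.
have q_ps : q \in ps by rewrite mem_filter q_pr q_odd mem_iota.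
pose j : 'I_m := Ordinal (etrans (index_mem q ps) q_ps).
have pj : p j = q by rewrite /p nth_index.
have {nq} := nq; rewrite -pj => /tP/eqP.
have [pj_pr pj_odd] := pP j.
rewrite eq_pow2_mod_omega // => /eqP k_t; apply: (xP j).
have /dvdnP[c Lc] : omega (p j) %| L by rewrite /L (bigD1 j) //= dvdn_mulr.
rewrite modz_nat -k_t -modz_nat PoszD gez0_abs; last first.
  by rewrite modz_ge0 // -lt0n.
set r := (x %% L)%Z; rewrite {1}(divz_eq x L) -/r Lc PoszM mulrA.
by rewrite modzMDl addrC modzMDl.
Qed.

(* [q] is shifted: the primes in ]y, s] are the [q.+1] with [y <= q < s]. *)
Lemma odd_exceptions_bound (y : nat) : ~ odd_prime_cover ->
  exists T M : nat, forall N s, N < s.+1 ^ 2 ->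
    \sum_(1 <= n < N.+1 | odd n && ~~ `[< squarefree_plus_pow2 n >]) 1
      <= T + \sum_(y <= q < s) N %/ q.+1 ^ 2 + M * s.
Proof.
move=> no_cover.
pose M := y`! ^ 2.
have M_gt0 : 0 < M by rewrite expn_gt0 fact_gt0.
have /choice[k kP] (b : nat) : exists k, 0 < k /\
    forall p, prime p -> odd p -> p <= y -> b != 2 ^ k %[mod p ^ 2].
  by have [l l_gt0 lP] := avoiding_exponent y b no_cover; exists l.
(* Numbers up to [T] are all counted as exceptions; beyond [T], every [n - 2 ^ k b] is positive. *)
pose T := \max_(b < M) 2 ^ k b.
exists T, M => N s N_s.
pose c b q := chinese M (q.+1 ^ 2) b (2 ^ k b).
(* A union bound by indicators. Here [q.+1] runs over all integers coprime to [M], not only primes;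
   coprimality makes [c b q] a Chinese remainder. *)
have cover n : 0 < n <= N -> odd n -> ~ squarefree_plus_pow2 n ->
    1 <= (n <= T) + \sum_(b < M) \sum_(y <= q < s | coprime M (q.+1 ^ 2))
           (n == c b q %[mod M * q.+1 ^ 2]).
  case/andP=> n_gt0 n_N n_odd n_exc.
  have [//|T_n] := leqP n T; rewrite add0n lt0n.
  pose b : 'I_M := Ordinal (ltn_pmod n M_gt0).
  have k_n : 2 ^ k b < n by apply: leq_ltn_trans T_n; exact: (leq_bigmax b).
  have [k_gt0 k_avoid] := kP b.
  apply: contra_notN n_exc => /eqP sum0.
  exists (n - 2 ^ k b), (k b); split; last by rewrite subnK // ltnW.
  split=> [|q q_pr]; first by rewrite subn_gt0.
  apply/negP => q2_dvd.
  have n_q : n == 2 ^ k b %[mod q ^ 2] by rewrite eqn_mod_dvd // ltnW.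
  have q_odd : odd q.
    case: (even_prime q_pr) => // q2; move: q2_dvd; rewrite q2 => /dvdnP[d dE].
    have : odd (n - 2 ^ k b).
      rewrite oddB ?(ltnW k_n) // n_odd oddX /= orbF.
      by case: (k b) k_gt0.
    by rewrite dE oddM andbF.
  have q_gt0 := prime_gt0 q_pr.
  have y_q : y < q.
    rewrite ltnNge; apply/negP => q_y.
    have := k_avoid q q_pr q_odd q_y.
    have qM : q ^ 2 %| M by rewrite dvdn_exp2r // dvdn_fact // q_gt0.
    by rewrite /= (modn_dvdm _ qM) n_q.
  (* Indeed [q ^ 2 <= n - 2 ^ k b <= N < s.+1 ^ 2]. *)
  have q_s : q <= s.
    rewrite -ltnS -(@ltn_exp2r _ _ 2) //; apply: leq_ltn_trans N_s.
    apply: leq_trans n_N; apply: leq_trans (leq_subr (2 ^ k b) n).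
    by apply: dvdn_leq; rewrite ?subn_gt0.
  have cop : coprime M (q ^ 2).
    rewrite coprimeXl // coprimeXr // coprime_sym prime_coprime //.
    apply/negP; rewrite fact_prod Euclid_dvd_prod // big_has => /hasP[i].
    rewrite mem_index_iota => /andP[i_gt0 i_y] /dvdn_leq; lia.
  have [q' q'E] : exists q', q = q'.+1 by exists q.-1; rewrite prednK.
  subst q.
  move/eqP: sum0; rewrite sum_nat_eq0 => /forallP/(_ b) /=.
  rewrite sum_nat_seq_eq0 => /allP/(_ q').
  rewrite mem_index_iota -ltnS y_q q_s cop => /(_ isT) /=.
  rewrite eqb0 chinese_remainder // chinese_modl // chinese_modr // n_q.
  by rewrite modn_mod eqxx.
rewrite big_mkcond /=.
pose f n b q : nat := n == c b q %[mod M * q.+1 ^ 2].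
apply: (@leq_trans (\sum_(1 <= n < N.+1)
   ((n <= T) + \sum_(b < M) \sum_(y <= q < s | coprime M (q.+1 ^ 2)) f n b q))).
  rewrite !big_nat leq_sum // => n n_N.
  by case: ifPn => // /andP[n_odd /asboolPn n_exc]; exact: cover.
rewrite big_split /= -addnA leq_add //.
  rewrite -big_mkcond /= sum1_count -[leqRHS](size_iota 1) -size_filter.
  rewrite uniq_leq_size ?filter_uniq ?iota_uniq // => n.
  by rewrite mem_filter mem_index_iota mem_iota; lia.
rewrite exchange_big /=.
(* This bound is independent of [b], so summing over [b] multiplies it by [M]: the factor [1/M]
   cancels, and the rounding term 1 becomes [M] for each [q], hence at most [M * s] in all. *)
apply: (@leq_trans (\sum_(b < M) \sum_(y <= q < s) ((N %/ q.+1 ^ 2) %/ M).+1)).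
  apply: leq_sum => b _; rewrite exchange_big /= big_mkcond /= leq_sum // => q _.
  case: ifP => // _; rewrite -big_mkcond /= sum1_count.
  rewrite -divnMA [_ * M]mulnC /index_iota subn1.
  by apply: count_residue_le; rewrite muln_gt0 M_gt0 expn_gt0.
rewrite big_const_ord iter_addn_0 mulnC big_distrr /=.
apply: (@leq_trans (\sum_(y <= q < s) (N %/ q.+1 ^ 2 + M))).
  by apply: leq_sum => q _; rewrite mulnS addnC leq_add2r mulnC leq_trunc_div.
by rewrite big_split leq_add2l /= sum_nat_const_nat mulnC leq_mul2l leq_subr orbT.
Qed.

Lemma exists_sqrt (N : nat) : exists s, s ^ 2 <= N < s.+1 ^ 2.
Proof.
have ex : exists s, s ^ 2 <= N by exists 0.
have ub s : s ^ 2 <= N -> s <= N by rewrite -mulnn; case: s => // s; nia.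
case: (ex_maxnP ex ub) => s s_N s_max; exists s.
by rewrite s_N ltnNge; apply/negP => /s_max; rewrite ltnn.
Qed.

(** Each of the three terms of the bound is made at most [e / 3 * X], with [y] chosen first because
    [T] and [M] depend on it. *)
Lemma almost_all_odd_no_cover (R : realType) : ~ odd_prime_cover ->
  almost_all_odd R squarefree_plus_pow2.
Proof.
move=> no_cover; apply/(@eqoP _ _ R^o R^o (pinfty_filter_on R)) => e e_gt0.
pose y := (Num.truncn (3 / e)%R).+1.
have y_e : (y%:R^-1 <= e / 3)%R.
  rewrite -[leRHS]invrK lef_pV2 ?posrE ?ltr0n ?invr_gt0 ?divr_gt0 //.
  by rewrite invf_div ltW // truncnS_gt.
have [T [M bound]] := odd_exceptions_bound y no_cover.
(* Once [s0 <= s], both [y <= s] and [M <= e / 3 * s] hold; the latter gives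
   [M * s <= e / 3 * s ^ 2 <= e / 3 * X]. *)
pose s0 := ((Num.truncn (3 * M%:R / e)%R).+1 + y)%N.
exists ((s0 ^ 2)%:R + 3 * T%:R / e)%R; split; first exact: num_real.
move=> X X_gt.
have T_ge0 : (0 <= 3 * T%:R / e)%R by rewrite divr_ge0 ?mulr_ge0 ?ler0n // ltW.
have X_ge0 : (0 <= X)%R by apply: le_trans (ltW X_gt); rewrite addr_ge0 ?ler0n.
set N := Num.truncn X.
have N_X : (N%:R <= X)%R by rewrite truncn_le.
have [s /andP[s_N N_s]] := exists_sqrt N.
have s0_N : s0 ^ 2 <= N.
  rewrite leqNgt; apply/negP; rewrite ltnNge -ltnS ltnNge negbK => N_s0.
  have := truncnS_gt X; rewrite -/N ltNge => /negP; apply.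
  apply: le_trans (ltW X_gt); apply: le_trans (_ : (s0 ^ 2)%:R <= _)%R.
    by rewrite ler_nat.
  by rewrite lerDl.
have s0_s : s0 <= s by rewrite -ltnS -(@ltn_exp2r _ _ 2) //; exact: leq_ltn_trans N_s.
have y_s : y <= s by apply: leq_trans s0_s; rewrite leq_addl.
rewrite (ger0_norm X_ge0) ger0_norm ?ler0n //.
have {}bound := bound N s N_s; rewrite -(ler_nat R) !natrD natrM in bound.
apply: le_trans bound _.
have sum_le : ((\sum_(y <= q < s) N %/ q.+1 ^ 2)%N%:R <= e / 3 * X)%R.
  apply: le_trans (sum_divn_sqr_le R N _ y_s) _ => //.
  rewrite mulrC ler_pM ?ler0n // ?subr_ge0 ?lef_pV2 ?posrE ?ltr0n ?ler_nat //.
    by apply: leq_trans y_s.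
  by rewrite (le_trans _ y_e) // gerBl invr_ge0.
have T_le : (T%:R <= e / 3 * X)%R.
  have : (3 * T%:R / e <= X)%R.
    by apply: le_trans (ltW X_gt); rewrite lerDr.
  rewrite ler_pdivrMr //; lra.
have M_s : (M%:R <= e / 3 * s%:R)%R.
  have : (3 * M%:R / e <= s%:R)%R.
    apply: ltW; apply: lt_le_trans (truncnS_gt _) _.
    by rewrite ler_nat; apply: leq_trans s0_s; rewrite leq_addr.
  rewrite ler_pdivrMr //; lra.
have Ms_le : (M%:R * s%:R <= e / 3 * X)%R.
  apply: le_trans (ler_wpM2r (ler0n _ s) M_s) _.
  rewrite -(mulrA (e / 3)%R) ler_wpM2l ?divr_ge0 ?(ltW e_gt0) // -natrM mulnn.
  by apply: le_trans N_X; rewrite ler_nat.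
lra.
Qed.

(** * A cover yields a whole residue class of exceptions *)

Lemma cover_exceptions : odd_prime_cover ->
  exists n0 D, [/\ n0 < D, odd n0 &
    forall n, n = n0 %[mod D] -> odd n && ~~ `[< squarefree_plus_pow2 n >]].
Proof.
move=> [m [p [a [_ pP p_inj p_cov]]]].
have omega_gt0 j : 0 < omega (p j) by exact: order_gt0.
pose t j := `|(a j %% omega (p j))%Z|%N.
(* The index [None] carries the parity condition alongside the conditions modulo [p j ^ 2]. *)
pose d (i : option 'I_m) := if i is Some j then p j ^ 2 else 2.
pose r (i : option 'I_m) := if i is Some j then 2 ^ t j else 1.
have d_cop : {in enum {: option 'I_m} &, forall i j, i != j -> coprime (d i) (d j)}.
  move=> [i|] [j|] _ _ //= ij; last 2 first.
  - by rewrite coprimeXl // coprimen2; case: (pP i).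
  - by rewrite coprimeXr // coprime2n; case: (pP j).
  rewrite coprimeXl // coprimeXr // prime_coprime; last by case: (pP i).
  rewrite dvdn_prime2; [|by case: (pP i)|by case: (pP j)].
  by apply: contraNN ij => /eqP/p_inj ->.
have [n1 n1P] := chinese_seq r (enum_uniq _) d_cop.
pose D := \prod_i d i.
have d_D i : d i %| D by rewrite /D (bigD1 i) //= dvdn_mulr.
have D_gt0 : 0 < D.
  by rewrite prodn_gt0 // => -[j|] //=; rewrite expn_gt0 prime_gt0 //; case: (pP j).
have nP n i : n = n1 %[mod D] -> n = r i %[mod d i].
  move=> n_n1; rewrite -(modn_dvdm _ (d_D i)) n_n1 modn_dvdm //.
  by rewrite n1P // mem_enum.
have n_odd n : n = n1 %[mod D] -> odd n.
  by move/(nP _ None) => /= n2; rewrite -[n]odd_double_half oddD odd_double -modn2 n2.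
exists (n1 %% D), D; split; first exact: ltn_pmod.
  by apply: n_odd; rewrite modn_mod.
move=> n; rewrite modn_mod => n_n1; rewrite n_odd //=.
apply/asboolPn => -[s [k [[s_gt0 s_sqf] n_sk]]].
(* The class containing [k] gives [2 ^ k = 2 ^ t j = n] modulo [p j ^ 2], so [p j ^ 2] divides
   [s]. *)
have [j kj] := p_cov k.
have [pj_pr pj_odd] := pP j.
have /negP := s_sqf _ pj_pr; apply.
have -> : s = n - 2 ^ k by rewrite n_sk addnK.
rewrite -eqn_mod_dvd; last by rewrite n_sk leq_addl.
rewrite (nP n (Some j) n_n1) /= eq_pow2_mod_omega //.
apply/eqP/eqP; rewrite -eqz_nat -!modz_nat kj gez0_abs ?modz_mod //.
by rewrite modz_ge0 // -lt0n.
Qed.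

(** At [X = t * D] the class contains at least [t] exceptions, while the little-o bound with
    constant [1/(2 * D)] allows only [t / 2]. *)
Lemma cover_not_almost_all_odd (R : realType) : odd_prime_cover ->
  ~ almost_all_odd R squarefree_plus_pow2.
Proof.
move=> /cover_exceptions[n0 [D [n0_D n0_odd n0P]]].
move=> /(@eqoP _ _ R^o R^o (pinfty_filter_on R)).
have D_gt0 : (0 < D%:R :> R)%R by rewrite ltr0n (leq_trans _ n0_D).
move=> /(_ (2 * D%:R)^-1%R); rewrite invr_gt0 mulr_gt0 // => /(_ isT)[B [_ BP]].
pose t := (Num.truncn B).+1.
have tD_B : (B < (t * D)%:R)%R.
  apply: lt_le_trans (truncnS_gt B) _; rewrite ler_nat leq_pmulr //.
  exact: leq_trans n0_D.
have := BP _ tD_B; rewrite /= !ger0_norm ?ler0n //; apply/negP; rewrite -ltNge.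
apply: lt_le_trans (_ : t%:R <= _)%R.
  have t_gt0 : (0 < t%:R :> R)%R by rewrite ltr0n.
  have -> : ((2 * D%:R)^-1 * (t * D)%:R = t%:R / 2 :> R)%R.
    rewrite natrM; field; lra.
  lra.
rewrite ler_nat /odd_exceptions natrK.
apply: leq_trans (_ : count (fun n => n == n0 %[mod D]) (iota 1 (t * D)) <= _).
  apply: leq_trans (divn_leq_count_residue _ n0_D (odd_gt0 n0_odd)).
  by rewrite mulnK // (leq_trans _ n0_D).
by rewrite sum1_count /index_iota subn1 /= sub_count // => n /eqP/n0P.
Qed.

Theorem theorem6p2 (R : realType) :
  almost_all_odd R squarefree_plus_pow2 <->
  ~ (exists (m : nat) (p : 'I_m -> nat) (a : 'I_m -> int),
       [/\ (1 <= m)%N,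
           forall j : 'I_m, prime (p j) /\ odd (p j),
           injective p
         & covers_Z a (fun j : 'I_m => omega (p j))]).
Proof.
split; last exact: almost_all_odd_no_cover.
by move=> almost_all /(@cover_not_almost_all_odd R).
Qed.
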